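(* Let $(X_t)_{t\in\mathbb Z}$ be a stationary Markov chain. Let $2\le m\le k$ and let $h\in\mathcal I_m$. Define $$\widehat h_{m,k}(x_1,\ldots,x_k)=\sum_{i=1}^{k-m+1}h(x_i,\ldots,x_{i+m-1}).$$ For this function the Green--Kubo series is finite (only finitely many of the terms $P_k^r\widehat h_{m,k}$ and $(P_k^* )^r\widehat h_{m,k}$, $r\ge1$, are nonzero), and $$B_k\widehat h_{m,k}=(k-m+1)\,\widehat h_{m,k}.$$
   Context: $(X_t)_{t\in\mathbb Z}$ is a stationary Markov chain on a measurable space $(E,\mathcal E)$ with invariant distribution $\nu$ and transition kernel $K$. For $n\ge 1$, $\pi_n$ is the law of $(X_1,\ldots,X_n)$, i.e. $\pi_n(dx_1,\ldots,dx_n)=\nu(dx_1)K(x_1,dx_2)\cdots K(x_{n-1},dx_n)$, and $\mathcal H_n=L^2_0(\pi_n)$ is the Hilbert space of real-valued $f\in L^2(\pi_n)$ with $\int f\,d\pi_n=0$, identified with the random variables $f(X_1,\ldots,X_n)$. The transition operator of the $k$-window chain $(X_t,\ldots,X_{t+k-1})$ acts on $\mathcal H_k$ by $$(P_kf)(x_1,\ldots,x_k)=\int_E f(x_2,\ldots,x_k,z)\,K(x_k,dz),$$ and $P_k^*$ is its Hilbert-space adjoint on $\mathcal H_k$. The Green--Kubo covariance operator is $B_k=I+\sum_{r\ge1}P_k^r+\sum_{r\ge1}(P_k^* )^r$, defined on those $f\in\mathcal H_k$ for which the series converges. Incremental space at block length $m\ge2$: let $W_{m-1}^L\subset\mathcal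 H_m$ be the subspace of centered square-integrable functions of $(X_1,\ldots,X_{m-1})$ and $W_{m-1}^R\subset\mathcal H_m$ the subspace of centered square-integrable functions of $(X_2,\ldots,X_m)$. Then $\mathcal I_m=(W_{m-1}^L+W_{m-1}^R)^\perp$, the orthogonal complement in $\mathcal H_m$; equivalently, $f\in\mathcal I_m$ iff $f\in\mathcal H_m$, $E(f\mid X_1,\ldots,X_{m-1})=0$ and $E(f\mid X_2,\ldots,X_m)=0$. *)

(* Defs.v *)
From HB Require Import structures.
From mathcomp Require Import all_boot all_order all_algebra.
From mathcomp Require Import all_classical all_reals all_analysis.

Set Implicit Arguments.
Unset Strict Implicit.
Unset Printing Implicit Defensive.

Import Order.TTheory GRing.Theory Num.Theory.
Import numFieldNormedType.Exports.

Local Open Scope classical_set_scope.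
Local Open Scope ring_scope.

(* [window i n s] is the block of length n starting at position i (counted
   from 0); the default [point] is irrelevant as long as i + n <= size s. *)
Definition window d (E : measurableType d) (i n : nat) (s : seq E) :
  n.-tuple E := [tuple nth point s (i + j) | j < n].

Definition block d d' (Om : measurableType d) (E : measurableType d')
    (X : int -> {mfun Om >-> E}) (t : int) (n : nat) (w : Om) : n.-tuple E :=
  [tuple X (t + (j : nat)%:Z) w | j < n].

Lemma measurable_block d d' (Om : measurableType d) (E : measurableType d')
    (X : int -> {mfun Om >-> E}) (t : int) (n : nat) :
  measurable_fun [set: Om] (block X t n).
Proof.
apply/measurable_fun_tnthP => i.
rewrite (_ : _ \o _ = X (t + (i : nat)%:Z)); first exact: measurable_funPT.
by apply/funext => w /=; rewrite tnth_mktuple.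
Qed.

HB.instance Definition _ d d' (Om : measurableType d) (E : measurableType d')
    (X : int -> {mfun Om >-> E}) (t : int) (n : nat) :=
  isMeasurableFun.Build _ _ _ _ (block X t n) (@measurable_block _ _ _ _ X t n).

Definition past d d' (Om : measurableType d) (E : measurableType d')
    (X : int -> {mfun Om >-> E}) (t : int) : set (set Om) :=
  <<s [set F | exists s A, [/\ (s <= t)%R, measurable A & F = X s @^-1` A]] >>.

Record stationary_markov_chain d d' (Om : measurableType d)
    (E : measurableType d') (R : realType) (P : probability Om R)
    (nu : probability E R) (K : R.-pker E ~> E)
    (X : int -> {RV P >-> E}) : Prop := StationaryMarkovChain {
  smc_invariant : forall A, measurable A ->
    (\int[nu]_x K x A = nu A)%E ;
  smc_marginal : forall t A, measurable A -> P (X t @^-1` A) = nu A ;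
  smc_stationary : forall (s t : int) (n : nat) (A : set (n.-tuple E)),
    measurable A -> P (block X s n @^-1` A) = P (block X t n @^-1` A) ;
  smc_markov : forall (t : int) (F : set Om) (A : set E),
    past X t F -> measurable A ->
    (P (F `&` X (t + 1)%R @^-1` A) = \int[P]_(w in F) K (X t w) A)%E }.

(* pi_n, the law of (X_1, ..., X_n) *)
Definition block_law d d' (Om : measurableType d) (E : measurableType d')
    (R : realType) (P : probability Om R) (X : int -> {RV P >-> E}) (n : nat) :
  probability (n.-tuple E) R := distribution P (block X 1 n).

(* Elements of L^2 spaces are represented by everywhere defined measurable
   functions; equality in L^2 is almost-everywhere equality. *)
Section Hilbert.
Context d (T : measurableType d) (R : realType) (mu : probability T R).
Implicit Types f g : T -> R.

Definition inner f g : R := \int[mu]_x (f x * g x).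

Definition L20 : set (T -> R) :=
  [set f | f \in Lfun mu 2%:E /\ \int[mu]_x f x = 0].

Definition orthocomplement (S : set (T -> R)) : set (T -> R) :=
  [set f | L20 f /\ forall g, S g -> inner f g = 0].

(* The adjoint of A on L20: [adjoint A f] is the element g of L20, unique up to
   null sets, with <A u, f> = <u, g> for all u. For bounded A it exists by the
   Riesz theorem, so the default value of [xget] plays no role. *)
Definition adjoint (A : (T -> R) -> (T -> R)) f : T -> R :=
  xget (cst 0) [set g | L20 g /\ forall u, L20 u -> inner (A u) f = inner u g].

Definition L2_series (u : nat -> T -> R) f : Prop :=
  L20 f /\
  (fun n => 'N[mu]_2%:E[EFin \o (fun x => \sum_(1 <= r < n.+1) u r x - f x)%R])%E
    @ \oo --> 0%E.

Definition nonzero_terms (u : nat -> T -> R) : set nat :=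
  [set r | (0 < r)%N /\ ~ (u r = cst 0 %[ae mu])].

(* The graph of B = I + \sum_(r >= 1) A^r + \sum_(r >= 1) (adjoint A)^r:
   it holds when f is in the domain of B and B f = g. *)
Definition green_kubo (A : (T -> R) -> (T -> R)) f g : Prop :=
  L20 f /\ exists g1 g2,
    [/\ L2_series (fun r => iter r A f) g1,
        L2_series (fun r => iter r (adjoint A) f) g2 &
        g = f \+ g1 \+ g2 %[ae mu]].

End Hilbert.

(* (P_k f)(x_1, ..., x_k) = \int f(x_2, ..., x_k, z) K(x_k, dz) *)
Definition transition d (E : measurableType d) (R : realType)
    (K : R.-pker E ~> E) (k : nat) (f : k.-tuple E -> R) (x : k.-tuple E) : R :=
  \int[K (last point x)]_z f (window 1 k (rcons x z)).
Arguments transition {d E R} K k f x.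

Section Incremental.
Context d d' (Om : measurableType d) (E : measurableType d') (R : realType).
Context (P : probability Om R) (X : int -> {RV P >-> E}) (m : nat).

Definition WL : set (m.-tuple E -> R) :=
  [set f | L20 (block_law X m) f /\
     exists2 g : m.-1.-tuple E -> R, measurable_fun [set: m.-1.-tuple E] g &
       f = (fun x => g (window 0 m.-1 x)) %[ae block_law X m]].

Definition WR : set (m.-tuple E -> R) :=
  [set f | L20 (block_law X m) f /\
     exists2 g : m.-1.-tuple E -> R, measurable_fun [set: m.-1.-tuple E] g &
       f = (fun x => g (window 1 m.-1 x)) %[ae block_law X m]].

Definition incremental : set (m.-tuple E -> R) :=
  orthocomplement (block_law X m)
    [set f | exists u v, [/\ WL u, WR v & f = u \+ v]].

End Incremental.

Definition hhat d (E : measurableType d) (R : realType) (m k : nat)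
    (h : m.-tuple E -> R) (x : k.-tuple E) : R :=
  \sum_(0 <= i < k - m + 1) h (window i m x).
Arguments hhat {d E R m} k h x.

(* Main.v *)
Require Import Defs.
From HB Require Import structures.
From mathcomp Require Import all_boot all_order all_algebra.
From mathcomp Require Import all_classical all_reals all_analysis.
From mathcomp Require Import measurable_realfun ring lra.
Import Order.TTheory GRing.Theory Num.Theory.
Import numFieldNormedType.Exports.
Local Open Scope classical_set_scope.
Local Open Scope ring_scope.

Set Implicit Arguments.
Unset Strict Implicit.
Unset Printing Implicit Defensive.

(** Write [N = k - m + 1] and [g_i x = h (x_i, ..., x_(i+m-1))], so that
[hhat = g_0 + ... + g_(N-1)] (positions counted from 0). The operator [P_k]
sends [g_i] to [g_(i+1)], except that it kills [g_(N-1)] because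
[E(h | X_1, ..., X_(m-1)) = 0]. Dually, the adjoint [Q_k] of [P_k] sends [g_i]
to [g_(i-1)] and kills [g_0]: [E(h | X_2, ..., X_m) = 0], and by the Markov
property conditioning on further future coordinates changes nothing. Hence
[P_k^r hhat] and [Q_k^r hhat] are the sums of the last, resp. first, [N - r] of
the [g_i], and in [B_k hhat] each [g_i] is counted [1 + i + (N - 1 - i) = N]
times. *)

(** * Square-integrable functions *)

Section SquareIntegrable.
Context d (T : measurableType d) (R : realType) (mu : probability T R).
Implicit Types f g u : T -> R.

(** Turns membership in [Lfun] into integrability of the square, the form to which change of
    variables and disintegration apply. *)
Lemma Lfun2P f : f \in Lfun mu 2%:E <->
  measurable_fun [set: T] f /\
  mu.-integrable [set: T] (EFin \o (fun x => f x ^+ 2)).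
Proof.
split=> [f2|[mf]].
  split; last exact: Lfun2_integrable_sqr.
  by move: f2; rewrite inE => /andP[+ _]; rewrite inE.
move=> /integrableP[_ fi]; rewrite inE; apply/andP; split; rewrite inE//=.
rewrite /finite_norm unlock poweR_lty//; move: fi; congr (_ < _)%E.
apply: eq_integral => x _ /=.
by rewrite ger0_norm ?sqr_ge0// powR_mulrn// real_normK// num_real.
Qed.

Lemma Lfun2_measurable f : f \in Lfun mu 2%:E -> measurable_fun [set: T] f.
Proof. by move=> /Lfun2P[]. Qed.

Lemma Lfun2_integrable f : f \in Lfun mu 2%:E ->
  mu.-integrable [set: T] (EFin \o f).
Proof.
move=> f2; apply/Lfun1_integrable/Lfun_subset12 => //.
by rewrite fin_num_measure.
Qed.

Lemma Lfun2_integrableM f g : f \in Lfun mu 2%:E -> g \in Lfun mu 2%:E ->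
  mu.-integrable [set: T] (EFin \o (fun x => f x * g x)).
Proof. by move=> f2 g2; apply/Lfun1_integrable; exact: Lfun2_mul_Lfun1. Qed.

Lemma Lfun2D f g : f \in Lfun mu 2%:E -> g \in Lfun mu 2%:E ->
  (fun x => f x + g x) \in Lfun mu 2%:E.
Proof.
have le12 : (1 <= 2%:E :> \bar R)%E by rewrite lee1n.
by move=> f2 g2; have [_] := Lfun_addr_closed mu le12; apply.
Qed.

Lemma Lfun2B f g : f \in Lfun mu 2%:E -> g \in Lfun mu 2%:E ->
  (fun x => f x - g x) \in Lfun mu 2%:E.
Proof.
move=> f2 g2; apply: Lfun2D => //.
rewrite (_ : (fun x => - g x) = -1 \o* g); last first.
  by apply/funext => x /=; rewrite mulrN1.
by apply: Lfun_scale => //; rewrite ler1n.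
Qed.

Lemma ae_eq_Rintegral f g : measurable_fun [set: T] f ->
  measurable_fun [set: T] g -> f = g %[ae mu] ->
  \int[mu]_x f x = \int[mu]_x g x.
Proof.
move=> mf mg fg; congr fine; apply: ae_eq_integral => //.
- exact/measurable_EFinP.
- exact/measurable_EFinP.
- by move: fg; apply: filterS => x fgx xT /=; rewrite fgx.
Qed.

Lemma innerC f g : inner mu f g = inner mu g f.
Proof. by apply: eq_Rintegral => x _; rewrite mulrC. Qed.

Lemma innerBl f g u : f \in Lfun mu 2%:E -> g \in Lfun mu 2%:E ->
  u \in Lfun mu 2%:E ->
  inner mu (fun x => f x - g x) u = inner mu f u - inner mu g u.
Proof.
move=> f2 g2 u2; rewrite /inner -RintegralB//; try exact: Lfun2_integrableM.
by apply: eq_Rintegral => x _; rewrite mulrBl.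
Qed.

Lemma innerDr f g u : f \in Lfun mu 2%:E -> g \in Lfun mu 2%:E ->
  u \in Lfun mu 2%:E ->
  inner mu u (fun x => f x + g x) = inner mu u f + inner mu u g.
Proof.
move=> f2 g2 u2; rewrite /inner -RintegralD//; try exact: Lfun2_integrableM.
by apply: eq_Rintegral => x _; rewrite mulrDr.
Qed.

Lemma inner_eq0 f : f \in Lfun mu 2%:E -> inner mu f f = 0 ->
  f = cst 0 %[ae mu].
Proof.
move=> f2 ff0; have /Lfun2P[mf fi] := f2.
have : (\int[mu]_x `|(f x ^+ 2)%:E| = 0)%E.
  (* [inner] is [fine] of an extended integral, so its vanishing says something about the integral
     only once the latter is known to be finite. *)
  rewrite -(fineK (x := integral _ _ _)); last first.
    rewrite ge0_fin_numE ?integral_ge0//.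
    by move/integrableP : fi => [].
  rewrite -[RHS]/((0 : R)%:E) -ff0; congr (fine _)%:E.
  apply: eq_integral => x _ /=.
  by rewrite ger0_norm ?sqr_ge0.
have mf2 : measurable_fun [set: T] (EFin \o (fun x => f x ^+ 2)).
  by apply/measurable_EFinP; exact: measurable_funX.
move=> /(ae_eq_integral_abs mu measurableT mf2).
apply: filterS => x + _ => /(_ I) /= [] /eqP.
by rewrite sqrf_eq0 => /eqP.
Qed.

Lemma L20D f g : L20 mu f -> L20 mu g -> L20 mu (fun x => f x + g x).
Proof.
move=> [f2 f0] [g2 g0]; split; first exact: Lfun2D.
by rewrite RintegralD ?f0 ?g0 ?addr0//; exact: Lfun2_integrable.
Qed.

Lemma L20_cst0 : L20 mu (cst 0).
Proof. by split; [exact: Lfun_cst|rewrite Rintegral_cst// mul0r]. Qed.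

Lemma L20_sum I (s : seq I) (F : I -> T -> R) (p : pred I) :
  (forall i, p i -> L20 mu (F i)) ->
  L20 mu (fun x => \sum_(i <- s | p i) F i x).
Proof.
move=> F0; elim: s => [|i s IH].
  rewrite (_ : (fun x => _) = cst 0); first exact: L20_cst0.
  by apply/funext => x; rewrite big_nil.
have [pi|pi] := boolP (p i); last first.
  by under eq_fun do rewrite big_cons (negbTE pi).
under eq_fun do rewrite big_cons pi.
by apply: L20D => //; exact: F0.
Qed.

End SquareIntegrable.

(** * Measure-preserving maps *)

Section MeasurePreserving.
Context d1 d2 (T1 : measurableType d1) (T2 : measurableType d2) (R : realType).
Variables (mu1 : probability T1 R) (mu2 : probability T2 R).

Definition measure_preserving (phi : T1 -> T2) :=
  measurable_fun [set: T1] phi /\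
  forall A, measurable A -> mu1 (phi @^-1` A) = mu2 A.

Variable phi : T1 -> T2.
Hypothesis phiP : measure_preserving phi.

Let mphi : measurable_fun [set: T1] phi. Proof. by case: phiP. Qed.

Lemma preserving_ae (Q : T2 -> Prop) :
  (\forall y \ae mu2, Q y) -> \forall x \ae mu1, Q (phi x).
Proof.
case: phiP => _ phiE [N [mN N0 QN]]; exists (phi @^-1` N); split.
- by rewrite -[X in measurable X]setTI; exact: mphi.
- by rewrite phiE.
- by move=> x /= /QN.
Qed.

Lemma preserving_ge0_integral (f : T2 -> \bar R) :
  measurable_fun [set: T2] f -> (forall y, 0 <= f y)%E ->
  (\int[mu1]_x f (phi x) = \int[mu2]_y f y)%E.
Proof.
case: phiP => _ phiE mf f0.
rewrite -(preimage_setT phi) -[LHS](ge0_integral_pushforward mphi)//.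
by apply: eq_measure_integral => A mA _; exact: phiE.
Qed.

(** Positive and negative parts are transported separately; both sides are then [fine] of the same
    difference. *)
Lemma preserving_Rintegral (f : T2 -> R) : measurable_fun [set: T2] f ->
  \int[mu1]_x f (phi x) = \int[mu2]_y f y.
Proof.
move=> /measurable_EFinP mf; congr fine; rewrite [LHS]integralE [RHS]integralE.
rewrite (funepos_comp (EFin \o f)) (funeneg_comp (EFin \o f)).
rewrite preserving_ge0_integral ?preserving_ge0_integral//.
- exact: measurable_funeneg.
- exact: measurable_funepos.
Qed.

Lemma preserving_Lfun2 (f : T2 -> R) : f \in Lfun mu2 2%:E ->
  f \o phi \in Lfun mu1 2%:E.
Proof.
move=> /Lfun2P[mf /integrableP[mf2 f2]]; apply/Lfun2P.
split; first exact: measurableT_comp.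
apply/integrableP; split; first exact: (measurableT_comp mf2).
rewrite (preserving_ge0_integral
  (f := abse \o (EFin \o (fun y => f y ^+ 2))))//.
- exact: measurableT_comp.
- by move=> y; exact: abse_ge0.
Qed.

Lemma preserving_L20 (f : T2 -> R) : L20 mu2 f -> L20 mu1 (f \o phi).
Proof.
move=> [f2 f0]; split; first exact: preserving_Lfun2.
by rewrite preserving_Rintegral//; exact: Lfun2_measurable f2.
Qed.

Lemma preserving_inner (f g : T2 -> R) : measurable_fun [set: T2] f ->
  measurable_fun [set: T2] g ->
  inner mu1 (f \o phi) (g \o phi) = inner mu2 f g.
Proof.
move=> mf mg; rewrite /inner.
by rewrite (preserving_Rintegral (f := f \* g))//; exact: measurable_funM.
Qed.

End MeasurePreserving.

(** * Disintegration along a probability kernel *)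

Section KernelPrecomposition.
Context d1 d2 d3 (X : measurableType d1) (Y : measurableType d2)
  (Z : measurableType d3) (R : realType) (k : R.-pker Y ~> Z) (f : X -> Y).

(** Serves to see [K (last point x)] as a kernel from tuples to [E]. The measurability proof is an
    argument so that the kernel structures can be attached to the term. *)
Definition kprecomp (mf : measurable_fun [set: X] f) (x : X) :
  {measure set Z -> \bar R} := k (f x).

Hypothesis mf : measurable_fun [set: X] f.

Let measurable_kprecomp U : measurable U ->
  measurable_fun [set: X] (kprecomp mf ^~ U).
Proof.
move=> mU.
exact: (measurableT_comp (f := k ^~ U) (measurable_kernel k U mU) mf).
Qed.

HB.instance Definition _ :=
  isKernel.Build _ _ _ _ _ (kprecomp mf) measurable_kprecomp.

Let kprecomp_prob x : kprecomp mf x [set: Z] = 1%E.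
Proof. exact: prob_kernel. Qed.

HB.instance Definition _ :=
  Kernel_isProbability.Build _ _ _ _ _ (kprecomp mf) kprecomp_prob.

End KernelPrecomposition.

Section KernelMean.
Context d1 d2 (T1 : measurableType d1) (T2 : measurableType d2) (R : realType)
  (kappa : R.-pker T1 ~> T2).

(** When [mu (dx) kappa (x, dy)] is the law of a pair [(a, b)], this is a version of the conditional
    expectation of [f (a, b)] given [a = x]. *)
Definition kernel_mean (f : T1 * T2 -> R) (x : T1) : R :=
  \int[kappa x]_y f (x, y).

Lemma kernel_integrable_cst x (c : R) :
  (kappa x).-integrable [set: T2] (EFin \o cst c).
Proof.
apply/integrableP; split => //=.
- by apply/measurable_EFinP; exact: measurable_cst.
- by rewrite integral_cst// prob_kernel mule1 ltry.
Qed.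

Lemma emeasurable_kernel_mean (f : T1 * T2 -> R) :
  measurable_fun [set: T1 * T2] f ->
  measurable_fun [set: T1] (fun x => \int[kappa x]_y (f (x, y))%:E)%E.
Proof.
move=> /measurable_EFinP mf.
rewrite (_ : (fun x => _) = (fun x =>
    \int[kappa x]_y (EFin \o f)^\+ (x, y) -
    \int[kappa x]_y (EFin \o f)^\- (x, y))%E); last first.
  apply/funext => x; rewrite integralE.
  rewrite (funepos_comp (EFin \o f) (pair x)).
  by rewrite (funeneg_comp (EFin \o f) (pair x)).
apply: emeasurable_funB; apply: measurable_fun_integral_sfinite_kernel => //.
- exact: measurable_funepos.
- exact: measurable_funeneg.
Qed.

Lemma measurable_kernel_mean (f : T1 * T2 -> R) :
  measurable_fun [set: T1 * T2] f -> measurable_fun [set: T1] (kernel_mean f).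
Proof.
move=> /emeasurable_kernel_mean mf.
exact: (measurableT_comp (fine_measurable measurableT) mf).
Qed.

End KernelMean.

Section Disintegration.
Context d d1 d2 (T : measurableType d) (T1 : measurableType d1)
  (T2 : measurableType d2) (R : realType).
Variables (rho : probability T R) (mu : probability T1 R).
Variables (kappa : R.-pker T1 ~> T2) (a : T -> T1) (b : T -> T2).
Hypotheses (ma : measurable_fun [set: T] a) (mb : measurable_fun [set: T] b).
(** The law of [(a, b)] under [rho] is [mu (dx) kappa (x, dy)], tested on rectangles only. *)
Hypothesis rect : forall A B, measurable A -> measurable B ->
  (rho (a @^-1` A `&` b @^-1` B) = \int[mu]_(x in A) kappa x B)%E.

Let mab : measurable_fun [set: T] (fun x => (a x, b x)).
Proof. exact/measurable_fun_pairP. Qed.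

Let msnd : measurable_fun [set: unit * T1] snd.
Proof. exact: measurable_snd. Qed.

Let mpair : measurable_fun [set: unit * T1 * T2] (fun p => (p.1.2, p.2)).
Proof.
apply/measurable_fun_pairP; split; last exact: measurable_snd.
exact: (measurableT_comp measurable_snd measurable_fst).
Qed.

(* The measure [mu (dx) kappa (x, dy)] is built as a composition of kernels, so
   that [integral_kcomp] computes integrals against it. *)
Let Kmu :=
  kprobability (measurable_cst (mu : pprobability T1 R) (D := [set: unit])).

Let prod_law := (Kmu \; (kprecomp kappa msnd \; kdirac mpair))%E.

Let integral_prod_law (f : T1 * T2 -> \bar R) : (forall p, 0 <= f p)%E ->
  measurable_fun [set: T1 * T2] f ->
  (\int[prod_law tt]_p f p = \int[mu]_x \int[kappa x]_y f (x, y))%E.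
Proof.
move=> f0 mf; rewrite /prod_law integral_kcomp//.
apply: eq_integral => x _; rewrite integral_kcomp//.
by apply: eq_integral => y _; rewrite integral_dirac// diracT mul1e.
Qed.

(** The law of [(a, b)] and [prod_law] are finite measures that agree on rectangles, a generating
    class closed under intersection; hence they are equal. *)
Lemma disintegration_ge0 (f : T1 * T2 -> \bar R) : (forall p, 0 <= f p)%E ->
  measurable_fun [set: T1 * T2] f ->
  (\int[rho]_x f (a x, b x) = \int[mu]_x \int[kappa x]_y f (x, y))%E.
Proof.
move=> f0 mf; rewrite -integral_prod_law//.
rewrite -(preimage_setT (fun x => (a x, b x))).
rewrite -[LHS](ge0_integral_pushforward mab)//.
apply: eq_measure_integral => C mC _.
pose G := [set A `*` B | A in @measurable _ T1 & B in @measurable _ T2].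
apply: (measure_unique G (fun=> setT)) => //.
- exact: measurable_prod_measurableType.
- move=> _ _ [A1 mA1 [B1 mB1 <-]] [A2 mA2 [B2 mB2 <-]].
  exists (A1 `&` A2); first exact: measurableI.
  by exists (B1 `&` B2); [exact: measurableI|rewrite setXI].
- by move=> _; exists setT => //; exists setT => //; rewrite setXTT.
- by rewrite bigcup_const.
- move=> _ [A mA [B mB <-]].
  rewrite [LHS](_ : _ = rho (a @^-1` A `&` b @^-1` B))// rect//.
  rewrite -[in RHS](setIT (A `*` B)) -integral_indic//; last exact: measurableX.
  rewrite integral_prod_law//; last first.
    by apply/measurable_EFinP; apply: measurable_indic; exact: measurableX.
  rewrite integral_mkcond; apply: eq_integral => x _; rewrite patchE.
  case: ifPn => xA.
    rewrite -[in LHS](setIT B) -integral_indic//; apply: eq_integral => y _.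
    by rewrite !indicE in_setX xA.
  rewrite integral0_eq// => y _.
  by rewrite !indicE in_setX (negbTE xA).
- by move=> k; rewrite [ltLHS](_ : _ = rho setT)// probability_setT ltry.
Qed.

Variable f : T1 * T2 -> R.
Hypothesis mf : measurable_fun [set: T1 * T2] f.

Let mfx x : measurable_fun [set: T2] (fun y => f (x, y)).
Proof. exact: (measurableT_comp mf (pair1_measurable x)). Qed.

(** Disintegrating [|f - g|], whose integral is zero, shows that for almost every [x] the sections
    of [f] and [g] agree up to a [kappa x]-null set. *)
Lemma kernel_mean_ae_eq g : measurable_fun [set: T1 * T2] g ->
  (\forall x \ae rho, f (a x, b x) = g (a x, b x)) ->
  kernel_mean kappa f = kernel_mean kappa g %[ae mu].
Proof.
move=> mg fg.
pose h p := `|(f p - g p)%:E|%E.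
have mh : measurable_fun [set: T1 * T2] h.
  apply: (measurableT_comp (f := abse)) => //; apply/measurable_EFinP.
  exact: measurable_funB.
have h0 p : (0 <= h p)%E by exact: abse_ge0.
have mkh : measurable_fun [set: T1] (fun x => \int[kappa x]_y h (x, y))%E.
  exact: measurable_fun_integral_sfinite_kernel.
have : (\int[mu]_x `|\int[kappa x]_y h (x, y)| = 0)%E.
  under eq_integral do rewrite gee0_abs ?integral_ge0//.
  rewrite -disintegration_ge0//.
  rewrite (ae_eq_integral (cst 0%E)) ?integral0//.
  - exact: (measurableT_comp mh mab).
  - by move: fg; apply: filterS => x fgx _ /=; rewrite /h fgx subrr abse0.
move=> /(ae_eq_integral_abs mu measurableT mkh); apply: filterS => x + _.
move=> /(_ I) hx0; congr fine; apply: ae_eq_integral => //.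
- exact/measurable_EFinP.
- by apply/measurable_EFinP; exact: (measurableT_comp mg (pair1_measurable x)).
have mhx : measurable_fun [set: T2] (fun y => (f (x, y) - g (x, y))%:E).
  apply/measurable_EFinP/measurable_funB => //.
  exact: (measurableT_comp mg (pair1_measurable x)).
move/(ae_eq_integral_abs (kappa x) measurableT mhx) : hx0.
apply: filterS => y + _ => /(_ I) /= [] /eqP.
by rewrite subr_eq0 => /eqP ->.
Qed.

Lemma kernel_ae_integrable :
  rho.-integrable [set: T] (fun x => (f (a x, b x))%:E) ->
  \forall x \ae mu, (kappa x).-integrable [set: T2] (fun y => (f (x, y))%:E).
Proof.
move=> /integrableP[_ fi].
have mk : measurable_fun [set: T1]
    (fun x => \int[kappa x]_y `|(f (x, y))%:E|)%E.
  apply: (measurable_fun_integral_sfinite_kernel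
    (fun p => `|(f p)%:E|%E)) => //.
  by apply: measurableT_comp => //; exact/measurable_EFinP.
have : mu.-integrable [set: T1] (fun x => \int[kappa x]_y `|(f (x, y))%:E|)%E.
  apply/integrableP; split => //.
  under eq_integral do rewrite gee0_abs ?integral_ge0//.
  rewrite -(disintegration_ge0 (f := fun p => `|(f p)%:E|%E))//.
  by apply: measurableT_comp => //; exact/measurable_EFinP.
move=> /(integrable_ae measurableT); apply: filterS => x /(_ I) fx.
apply/integrableP; split; first exact/measurable_EFinP.
by rewrite -ge0_fin_numE ?integral_ge0.
Qed.

(** Fubini from Tonelli: the two parts of [f] are disintegrated and recombined. The inner extended
    integral equals its [fine] at almost every [x], by [kernel_ae_integrable]. *)
Lemma disintegration :
  rho.-integrable [set: T] (fun x => (f (a x, b x))%:E) ->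
  \int[rho]_x f (a x, b x) = \int[mu]_x kernel_mean kappa f x.
Proof.
move=> fi.
have mEf : measurable_fun [set: T1 * T2] (EFin \o f).
  exact/measurable_EFinP.
have mp : measurable_fun [set: T1 * T2] (EFin \o f)^\+%E.
  exact: measurable_funepos.
have mn : measurable_fun [set: T1 * T2] (EFin \o f)^\-%E.
  exact: measurable_funeneg.
have ip : mu.-integrable [set: T1]
    (fun x => \int[kappa x]_y (EFin \o f)^\+%E (x, y))%E.
  apply/integrableP; split; first exact: measurable_fun_integral_sfinite_kernel.
  under eq_integral do rewrite gee0_abs ?integral_ge0//.
  rewrite -disintegration_ge0//.
  have := integral_funepos_lt_pinfty measurableT fi.
  by rewrite (funepos_comp (EFin \o f) (fun x => (a x, b x))).
have in_ : mu.-integrable [set: T1]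
    (fun x => \int[kappa x]_y (EFin \o f)^\-%E (x, y))%E.
  apply/integrableP; split; first exact: measurable_fun_integral_sfinite_kernel.
  under eq_integral do rewrite gee0_abs ?integral_ge0//.
  rewrite -disintegration_ge0//.
  have := integral_funeneg_lt_pinfty measurableT fi.
  by rewrite (funeneg_comp (EFin \o f) (fun x => (a x, b x))).
transitivity (fine (\int[mu]_x \int[kappa x]_y (f (x, y))%:E)%E).
  congr fine; rewrite integralE.
  rewrite (funepos_comp (EFin \o f) (fun x => (a x, b x))).
  rewrite (funeneg_comp (EFin \o f) (fun x => (a x, b x))).
  rewrite !disintegration_ge0// -(integralB measurableT ip in_).
  apply: eq_integral => x _; rewrite [RHS]integralE.
  rewrite (funepos_comp (EFin \o f) (pair x)).
  by rewrite (funeneg_comp (EFin \o f) (pair x)).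
congr fine; apply: ae_eq_integral => //.
- exact: emeasurable_kernel_mean.
- by apply/measurable_EFinP; exact: measurable_kernel_mean.
have := kernel_ae_integrable fi; apply: filterS => x fx _.
by rewrite fineK//; exact: integrable_fin_num.
Qed.

End Disintegration.

(** * Conditional expectation of square-integrable functions *)

Section SquareDisintegration.
Context d d1 d2 (T : measurableType d) (T1 : measurableType d1)
  (T2 : measurableType d2) (R : realType).
Variables (rho : probability T R) (mu : probability T1 R).
Variables (kappa : R.-pker T1 ~> T2) (a : T -> T1) (b : T -> T2).
Hypotheses (ma : measurable_fun [set: T] a) (mb : measurable_fun [set: T] b).
Hypothesis rect : forall A B, measurable A -> measurable B ->
  (rho (a @^-1` A `&` b @^-1` B) = \int[mu]_(x in A) kappa x B)%E.
Variable f : T1 * T2 -> R.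
Hypothesis mf : measurable_fun [set: T1 * T2] f.
Hypothesis f2 : (fun x => f (a x, b x)) \in Lfun rho 2%:E.

(* Jensen's inequality, from the nonnegativity of the conditional variance. *)
Lemma sqr_kernel_mean_le : \forall x \ae mu,
  kernel_mean kappa f x ^+ 2 <= kernel_mean kappa (fun p => f p ^+ 2) x.
Proof.
have mf2 : measurable_fun [set: T1 * T2] (fun p => f p ^+ 2).
  exact: measurable_funX.
have /Lfun2P[_ i2] := f2.
have /= := kernel_ae_integrable ma mb rect mf2 i2.
have /= := kernel_ae_integrable ma mb rect mf (Lfun2_integrable f2).
apply: filterS2 => x ix i2x; rewrite /kernel_mean.
set c := \int[kappa x]_y f (x, y).
have ic := kernel_integrable_cst kappa x (c ^+ 2).
have i1c : (kappa x).-integrable [set: T2]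
    (EFin \o (fun y => 2 * c * f (x, y))).
  exact: (integrableZl measurableT (2 * c) ix).
have : 0 <= \int[kappa x]_y (f (x, y) ^+ 2 - 2 * c * f (x, y) + c ^+ 2).
  apply: Rintegral_ge0 => y _.
  by rewrite (_ : _ + _ = (f (x, y) - c) ^+ 2) ?sqr_ge0//; ring.
rewrite RintegralD//; last exact: (integrableB measurableT i2x i1c).
rewrite RintegralB// RintegralZl// -/c Rintegral_cst// prob_kernel /=.
lra.
Qed.

(** Conditional expectation contracts the [L^2] norm: integrate [sqr_kernel_mean_le] and
    disintegrate the square of [f]. *)
Lemma kernel_mean_Lfun2 : kernel_mean kappa f \in Lfun mu 2%:E.
Proof.
have mf2 : measurable_fun [set: T1 * T2] (fun p => f p ^+ 2).
  exact: measurable_funX.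
have /Lfun2P[_ /= i2] := f2.
have mk := measurable_kernel_mean kappa mf.
apply/Lfun2P; split => //.
have mk2 : measurable_fun [set: T1]
    (EFin \o (fun x => kernel_mean kappa f x ^+ 2)).
  by apply/measurable_EFinP; exact: measurable_funX.
apply/integrableP; split => //.
have /integrableP[_] := i2; apply: le_lt_trans.
rewrite (disintegration_ge0 ma mb rect
  (f := fun p => `|(f p ^+ 2)%:E|%E))//; last first.
  by apply: measurableT_comp => //; exact/measurable_EFinP.
apply: ae_ge0_le_integral => //.
- exact: measurableT_comp.
- by move=> x _; exact: integral_ge0.
- apply: (measurable_fun_integral_sfinite_kernel
    (fun p => `|(f p ^+ 2)%:E|%E)) => //.
  by apply: measurableT_comp => //; exact/measurable_EFinP.
have /= := kernel_ae_integrable ma mb rect mf2 i2.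
apply: filterS2 sqr_kernel_mean_le => x fx i2x _ /=.
rewrite ger0_norm ?sqr_ge0//.
have -> : (\int[kappa x]_y `|f (x, y) ^+ 2|%:E)%E =
    (kernel_mean kappa (fun p => f p ^+ 2) x)%:E.
  rewrite fineK; last exact: integrable_fin_num.
  by apply: eq_integral => y _; rewrite ger0_norm ?sqr_ge0.
by rewrite lee_fin.
Qed.

(** Conditional expectation is adjoint to composition with [a]: the factor [g x] is constant in [y]
    and leaves the inner integral. *)
Lemma disintegration_inner g : g \in Lfun mu 2%:E ->
  g \o a \in Lfun rho 2%:E ->
  inner rho (fun x => f (a x, b x)) (g \o a) = inner mu (kernel_mean kappa f) g.
Proof.
move=> g2 ga2; have mg := Lfun2_measurable g2.
have mfg : measurable_fun [set: T1 * T2] (fun p => f p * g p.1).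
  by apply: measurable_funM => //; exact: (measurableT_comp mg measurable_fst).
have fgi := Lfun2_integrableM f2 ga2.
rewrite /inner (disintegration ma mb rect mfg fgi).
apply: ae_eq_Rintegral.
- exact: measurable_kernel_mean.
- by apply: measurable_funM => //; exact: measurable_kernel_mean.
have := kernel_ae_integrable ma mb rect mf (Lfun2_integrable f2).
by apply: filterS => x fx _; rewrite /kernel_mean /= RintegralZr.
Qed.

End SquareDisintegration.

(** * Windows and block laws *)

Section Windows.
Context d (E : measurableType d).

Lemma nth_window i n (s : seq E) j : (j < n)%N ->
  nth point (window i n s) j = nth point s (i + j).
Proof.
move=> jn; have -> : nth point (window i n s) j =
    tnth (window i n s) (Ordinal jn) by rewrite (tnth_nth point).
by rewrite tnth_mktuple.
Qed.

Lemma window_ext i n (s : seq E) (t : n.-tuple E) :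
  (forall j, (j < n)%N -> nth point s (i + j) = nth point t j) ->
  window i n s = t.
Proof.
move=> st; apply: eq_from_tnth => j.
by rewrite tnth_mktuple st// -tnth_nth.
Qed.

Lemma window_id n (x : n.-tuple E) : window 0 n x = x.
Proof. exact: window_ext. Qed.

Lemma window_window i m j n (s : seq E) : (i + m <= n)%N ->
  window i m (window j n s) = window (j + i) m s.
Proof.
move=> imn; apply: window_ext => l lm.
rewrite !nth_window ?addnA//.
by rewrite (leq_trans _ imn)// ltn_add2l.
Qed.

Lemma window_rcons i m (s : seq E) z : (i + m <= size s)%N ->
  window i m (rcons s z) = window i m s.
Proof.
move=> ims; apply: window_ext => l lm.
by rewrite nth_window// nth_rcons (leq_trans _ ims)// ltn_add2l.
Qed.

Lemma nth_rcons_tuple n (x : n.-tuple E) z j :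
  nth point [tuple of rcons x z] j =
  if (j < n)%N then nth point x j else if j == n then z else point.
Proof. by rewrite /= nth_rcons size_tuple. Qed.

Lemma window_rcons_last i m (s : seq E) z : (i + m)%N = size s ->
  window i m.+1 (rcons s z) = [tuple of rcons (window i m s) z].
Proof.
move=> ims; apply: window_ext => l lm.
rewrite nth_rcons_tuple nth_rcons -ims ltn_add2l eqn_add2l.
by case: (ltnP l m) => [jm|//]; rewrite nth_window.
Qed.

Lemma last_window i m (s : seq E) : (0 < m)%N -> (i + m)%N = size s ->
  last point (window i m s) = last point s.
Proof.
move=> m0 ims; rewrite -!nth_last nth_window size_tuple ?prednK//.
by rewrite -ims -!subn1 addnBA.
Qed.

(** Lets a function of a block be read as a function of the pair formed by its first [n] entries and
    its last one, as disintegration requires. *)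
Lemma rcons_window n (y : n.+1.-tuple E) :
  [tuple of rcons (window 0 n y) (nth point y n)] = y.
Proof.
rewrite -[RHS]window_id; apply/esym/window_ext => j; rewrite ltnS add0n => jn.
rewrite nth_rcons_tuple; case: (ltnP j n) => jn'; first by rewrite nth_window.
by have -> : j = n; [apply/eqP; rewrite eqn_leq jn|rewrite eqxx].
Qed.

Lemma measurable_nth n j :
  measurable_fun [set: n.-tuple E] (fun x : n.-tuple E => nth point x j).
Proof.
have [jn|nj] := ltnP j n; last first.
  rewrite (_ : (fun x => _) = cst point); first exact: measurable_cst.
  by apply/funext => x; rewrite nth_default ?size_tuple.
rewrite (_ : (fun x => _) = (@tnth n E)^~ (Ordinal jn)).
  exact: measurable_tnth.
by apply/funext => x; rewrite (tnth_nth point).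
Qed.

Lemma measurable_last n :
  measurable_fun [set: n.-tuple E] (fun x : n.-tuple E => last point x).
Proof.
rewrite (_ : (fun x => _) = (fun x : n.-tuple E => nth point x n.-1)).
  exact: measurable_nth.
by apply/funext => x; rewrite -nth_last size_tuple.
Qed.

Lemma measurable_window i m n :
  measurable_fun [set: n.-tuple E] (fun x : n.-tuple E => window i m x).
Proof.
apply/measurable_fun_tnthP => j.
rewrite (_ : _ \o _ = (fun x : n.-tuple E => nth point x (i + j))).
  exact: measurable_nth.
by apply/funext => x /=; rewrite tnth_mktuple.
Qed.

Lemma measurable_rcons n : measurable_fun [set: n.-tuple E * E]
  (fun p : n.-tuple E * E => [tuple of rcons p.1 p.2] : n.+1.-tuple E).
Proof.
apply/measurable_fun_tnthP => j; have [jn|nj] := ltnP j n.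
  rewrite (_ : _ \o _ = (fun x : n.-tuple E => nth point x j) \o fst).
    exact: (measurableT_comp (measurable_nth _) measurable_fst).
  by apply/funext => -[x z]; rewrite /comp (tnth_nth point) nth_rcons_tuple jn.
rewrite (_ : _ \o _ = snd); first exact: measurable_snd.
apply/funext => -[x z]; rewrite /comp (tnth_nth point) nth_rcons_tuple.
by rewrite ltnNge nj /= eqn_leq nj -ltnS ltn_ord.
Qed.

End Windows.

(** * Stationarity and the Markov property for block laws *)

Section BlockLaw.
Context d d' (Om : measurableType d) (E : measurableType d') (R : realType)
  (P : probability Om R) (nu : probability E R) (K : R.-pker E ~> E)
  (X : int -> {RV P >-> E}).
Hypothesis XP : stationary_markov_chain nu K X.

Lemma nth_block t n w j : (j < n)%N ->
  nth point (block X t n w) j = X (t + j%:Z) w.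
Proof.
by move=> jn; rewrite -[LHS](tnth_nth point _ (Ordinal jn)) tnth_mktuple.
Qed.

Lemma window_block i m t n w : (i + m <= n)%N ->
  window i m (block X t n w) = block X (t + i%:Z) m w.
Proof.
move=> imn; apply: window_ext => j jm.
by rewrite !nth_block ?PoszD ?addrA// (leq_trans _ imn)// ltn_add2l.
Qed.

(** This is stationarity: the window at position [i] of [(X_1, ..., X_n)] is the block starting at
    time [1 + i]. *)
Lemma window_preserving i m n : (i + m <= n)%N ->
  measure_preserving (block_law X n) (block_law X m) (fun x => window i m x).
Proof.
move=> imn; split=> [|A mA]; first exact: measurable_window.
rewrite [RHS](_ : _ = P (block X 1 m @^-1` A))//.
rewrite (smc_stationary XP 1 (1 + i%:Z) mA).
congr (P _); apply/seteqP; split => w /=; by rewrite window_block.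
Qed.

Lemma past_block n A : measurable A -> past X n%:Z (block X 1 n @^-1` A).
Proof.
move=> mA.
(* Equip [Om] with the sigma-algebra of the past and argue coordinatewise. *)
pose G :=
  [set F | exists s A, [/\ (s <= n%:Z)%R, measurable A & F = X s @^-1` A]].
have : measurable_fun [set: g_sigma_algebraType G]
    (block X 1 n : g_sigma_algebraType G -> _).
  apply/measurable_fun_tnthP => i _ B mB.
  rewrite setTI; apply: sub_sigma_algebra; exists (1 + i%:Z), B; split => //.
    by rewrite -(PoszD 1) lez_nat add1n ltn_ord.
  by apply/seteqP; split => w /=; rewrite tnth_mktuple.
by move=> /(_ measurableT A mA); rewrite setTI.
Qed.

(** The Markov property at time [n], in the form of the hypothesis [rect]. Positions count from 0
    and times from 1, so position [n] carries [X_(n+1)] and the last entry of an [n]-block is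
    [X_n]. *)
Lemma block_law_rect n A B : (0 < n)%N -> measurable A -> measurable B ->
  (block_law X n.+1 ((fun y : n.+1.-tuple E => window 0 n y) @^-1` A `&`
                     (fun y : n.+1.-tuple E => nth point y n) @^-1` B) =
   \int[block_law X n]_(x in A) kprecomp K (@measurable_last _ E n) x B)%E.
Proof.
move=> n0 mA mB.
have mbl : measurable_fun [set: Om] (block X 1 n) by exact: measurable_block.
rewrite [RHS](ge0_integral_pushforward mbl)//; last first.
  by apply: measurable_funTS; exact: measurable_kernel.
transitivity (P (block X 1 n @^-1` A `&` X (n%:Z + 1) @^-1` B)).
  congr (P _); apply/seteqP; split => w /=;
    by rewrite window_block ?add0n// addr0 nth_block// (addrC 1).
rewrite (smc_markov XP)//; last exact: past_block.
apply: eq_integral => w _ /=; rewrite /kprecomp; congr (K _ B).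
rewrite -nth_last size_tuple nth_block ?prednK//.
by rewrite -(PoszD 1) add1n prednK.
Qed.

End BlockLaw.

(** * Integrating out the last coordinate of a block *)

Section OneStep.
Context d d' (Om : measurableType d) (E : measurableType d') (R : realType)
  (P : probability Om R) (nu : probability E R) (K : R.-pker E ~> E)
  (X : int -> {RV P >-> E}).
Hypothesis XP : stationary_markov_chain nu K X.

(** The conditional expectation of [F (X_1, ..., X_(n+1))] given [X_1, ..., X_n]. By conversion,
    [transition K k f] is this mean for [f] composed with [window 1 k]. *)
Definition last_step_mean n (F : n.+1.-tuple E -> R) (x : n.-tuple E) : R :=
  \int[K (last point x)]_z F [tuple of rcons x z].

Variables (n : nat) (F : n.+1.-tuple E -> R).
Hypotheses (n0 : (0 < n)%N) (mF : measurable_fun [set: n.+1.-tuple E] F).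

Let f (p : n.-tuple E * E) : R := F [tuple of rcons p.1 p.2].

Let mf : measurable_fun [set: n.-tuple E * E] f.
Proof. exact: (measurableT_comp mF (@measurable_rcons _ E n)). Qed.

Let ma := @measurable_window _ E 0 n n.+1.
Let mb := @measurable_nth _ E n.+1 n.
Let rect A B := @block_law_rect _ _ _ _ _ _ _ _ _ XP n A B n0.
Let fE : F = fun y => f (window 0 n y, nth point y n).
Proof. by apply/funext => y; rewrite /f rcons_window. Qed.

Lemma measurable_last_step_mean :
  measurable_fun [set: n.-tuple E] (last_step_mean F).
Proof.
exact: (measurable_kernel_mean (kprecomp K (@measurable_last _ E n)) mf).
Qed.

Lemma last_step_mean_ae_eq G : measurable_fun [set: n.+1.-tuple E] G ->
  F = G %[ae block_law X n.+1] ->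
  last_step_mean F = last_step_mean G %[ae block_law X n].
Proof.
move=> mG FG.
apply: (kernel_mean_ae_eq ma mb rect mf
  (g := fun p => G [tuple of rcons p.1 p.2])).
  exact: (measurableT_comp mG (@measurable_rcons _ E n)).
by move: FG; apply: filterS => y FGy; rewrite /f !rcons_window; exact: FGy.
Qed.

Hypothesis F2 : F \in Lfun (block_law X n.+1) 2%:E.

Let f2 : (fun y : n.+1.-tuple E => f (window 0 n y, nth point y n)) \in
  Lfun (block_law X n.+1) 2%:E.
Proof. by rewrite -fE. Qed.

Lemma last_step_ae_integrable : {ae block_law X n, forall x : n.-tuple E,
  (K (last point x)).-integrable [set: E]
    (fun z => (F [tuple of rcons x z])%:E)}.
Proof. exact: (kernel_ae_integrable ma mb rect mf (Lfun2_integrable f2)). Qed.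

Lemma last_step_mean_Lfun2 : last_step_mean F \in Lfun (block_law X n) 2%:E.
Proof. exact: (kernel_mean_Lfun2 ma mb rect mf f2). Qed.

Lemma last_step_mean_inner g : g \in Lfun (block_law X n) 2%:E ->
  inner (block_law X n.+1) F (fun y : n.+1.-tuple E => g (window 0 n y)) =
  inner (block_law X n) (last_step_mean F) g.
Proof.
move=> g2; rewrite {1}fE; apply: (disintegration_inner ma mb rect mf f2) => //.
by apply: (preserving_Lfun2 (window_preserving XP _)).
Qed.

End OneStep.

(** * Incremental functions *)

Section Innovation.
Context d d' (Om : measurableType d) (E : measurableType d') (R : realType)
  (P : probability Om R) (nu : probability E R) (K : R.-pker E ~> E)
  (X : int -> {RV P >-> E}).
Hypothesis XP : stationary_markov_chain nu K X.
(** From here on the block length of [h] is written [m.+1], so that [m.-1] in [WL] and [WR] reduces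
    to [m]. *)
Variables (m : nat) (h : m.+1.-tuple E -> R).
Hypotheses (m0 : (0 < m)%N) (hI : incremental X h).

Let h2 : h \in Lfun (block_law X m.+1) 2%:E. Proof. by case: hI => -[]. Qed.
Let mh : measurable_fun [set: m.+1.-tuple E] h.
Proof. exact: Lfun2_measurable h2. Qed.

Lemma incremental_orthogonal i g : (i <= 1)%N ->
  g \in Lfun (block_law X m) 2%:E ->
  inner (block_law X m.+1) h (fun x : m.+1.-tuple E => g (window i m x)) = 0.
Proof.
move=> i1 g2; have im : (i + m <= m.+1)%N by rewrite -add1n leq_add2r.
have pres := window_preserving XP im.
have gw2 := preserving_Lfun2 pres g2; have mg := Lfun2_measurable g2.
have [[_ h0] horth] := hI.
(* [WL] and [WR] contain centered functions only. *)
set c := \int[block_law X m]_x g x.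
pose f (x : m.+1.-tuple E) := g (window i m x) - c.
have f2 : f \in Lfun (block_law X m.+1) 2%:E.
  by apply: Lfun2B => //; exact: Lfun_cst.
have f0 : L20 (block_law X m.+1) f.
  split=> //; rewrite RintegralB//; last 2 first.
  - exact: (Lfun2_integrable gw2).
  - exact: (Lfun2_integrable (Lfun_cst _ c _)).
  rewrite (preserving_Rintegral pres)// Rintegral_cst//.
  rewrite (_ : fine _ = 1); first by rewrite mulr1 subrr.
  exact: (congr1 fine (probability_setT (block_law X m.+1))).
have fw : exists2 g' : m.-tuple E -> R, measurable_fun [set: m.-tuple E] g' &
    f = (fun x => g' (window i m x)) %[ae block_law X m.+1].
  exists (fun y => g y - c); last exact: ae_eq_refl.
  by apply: measurable_funB.
have c2 : cst c \in Lfun (block_law X m.+1) 2%:E by exact: Lfun_cst.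
rewrite (_ : (fun x => _) = (fun x => f x + cst c x)); last first.
  by apply/funext => x; rewrite subrK.
rewrite innerDr// /inner RintegralZr//; last exact: Lfun2_integrable.
rewrite h0 mul0r addr0; apply: horth.
(* Zero lies in both [WL] and [WR], so it can fill the other summand: [f] belongs to [WL] when
   [i = 0] and to [WR] when [i = 1]. *)
have z0 : L20 (block_law X m.+1) (cst 0) by exact: L20_cst0.
have zL : WL X (cst 0 : m.+1.-tuple E -> R).
  by split=> //; exists (cst 0) => //; exact: ae_eq_refl.
have zR : WR X (cst 0 : m.+1.-tuple E -> R).
  by split=> //; exists (cst 0) => //; exact: ae_eq_refl.
case: i i1 {im pres gw2 f2} @f f0 fw => [_|[_|//]] f f0 fw.
- by exists f, (cst 0); split => //; apply/funext => x /=; rewrite addr0.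
- by exists (cst 0), f; split => //; apply/funext => x /=; rewrite add0r.
Qed.

(* The function [v = last_step_mean K h] is itself an admissible test function:
   [<v, v> = <h, v o window 0 m> = 0]. *)
Lemma last_step_mean_incremental :
  last_step_mean K h = cst 0 %[ae block_law X m].
Proof.
have hm2 := last_step_mean_Lfun2 XP m0 mh h2.
apply: inner_eq0 => //; rewrite -(last_step_mean_inner XP)//.
exact: (incremental_orthogonal (i := 0)).
Qed.

(* Integrating out the last coordinate replaces [u] by [last_step_mean K u],
   which is still square integrable, until [u] depends on
   [x_2, ..., x_(m+1)] only. *)
Lemma incremental_orthogonal_future j u : (m <= j)%N ->
  u \in Lfun (block_law X j) 2%:E ->
  inner (block_law X j.+1) (fun y : j.+1.-tuple E => u (window 1 j y))
    (fun y : j.+1.-tuple E => h (window 0 m.+1 y)) = 0.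
Proof.
elim: j u => [|j IH] u.
  by rewrite leqn0 => m00; move: m0; rewrite lt0n m00.
have pres1 := window_preserving XP (leqnn (1 + j.+1)).
(* If [m = j.+1], the window of [h] is the whole block and [u] depends on all entries but the first:
   orthogonality to [WR] concludes. *)
rewrite leq_eqVlt => /orP[/eqP mj|]; last rewrite ltnS => mj.
  move: u pres1; rewrite -mj => u pres1 u2; rewrite innerC.
  under [in X in inner _ X]eq_fun do rewrite window_id.
  exact: incremental_orthogonal.
have pres0 : measure_preserving (block_law X j.+1) (block_law X m.+1)
  (fun x : j.+1.-tuple E => window 0 m.+1 x).
  by apply: (window_preserving XP); rewrite add0n ltnS.
move=> u2; have uw2 := preserving_Lfun2 pres1 u2.
have hw2 := preserving_Lfun2 pres0 h2.
have mu := Lfun2_measurable u2.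
have j0 : (0 < j)%N by exact: leq_trans m0 mj.
transitivity (inner (block_law X j.+1)
    (last_step_mean K (fun y : j.+2.-tuple E => u (window 1 j.+1 y)))
    (fun x : j.+1.-tuple E => h (window 0 m.+1 x))).
  rewrite -(last_step_mean_inner XP)//; last exact: Lfun2_measurable uw2.
  by congr inner; apply/funext => y; rewrite window_window.
rewrite -[RHS](IH (last_step_mean K u) mj); last first.
  exact: (last_step_mean_Lfun2 XP j0 mu u2).
(* The kernel sees only the last entry, so integrating it out commutes with dropping the first
   coordinate. A last entry remains after the drop because [0 < j]. *)
congr inner; apply/funext => x; rewrite /last_step_mean last_window//.
  by apply: eq_Rintegral => z _ /=; rewrite window_rcons_last ?size_tuple.
by rewrite size_tuple.
Qed.

End Innovation.

(** * Finitely supported series *)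

Section FinitelySupportedSeries.
Context d (T : measurableType d) (R : realType) (mu : probability T R).
(** [u] stands for the iterates of an operator, known only up to null sets, and [v] for explicit
    representatives that vanish everywhere from rank [N] on. *)
Variables (u v : nat -> T -> R) (N : nat).
Hypothesis meas_u : forall r, measurable_fun [set: T] (u r).
Hypothesis uv : forall r, u r = v r %[ae mu].
Hypothesis vN : forall r, (N <= r)%N -> v r = cst 0.

Lemma finite_nonzero_terms : finite_set (nonzero_terms mu u).
Proof.
apply: (sub_finite_set _ (finite_II N)) => r [_ ur] /=.
by rewrite ltnNge; apply/negP => /vN vr; apply: ur; rewrite -vr; exact: uv.
Qed.

Lemma Lnorm2_ae0 (f : T -> R) : measurable_fun [set: T] f ->
  f = cst 0 %[ae mu] ->
  ('N[mu]_2%:E[EFin \o f] = 0)%E.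
Proof.
move=> mf f0; rewrite unlock.
have sqE x : (`|(EFin \o f) x| `^ 2 = (f x ^+ 2)%:E)%E.
  by rewrite /= powR_mulrn// real_normK// num_real.
under eq_integral do rewrite sqE.
rewrite (ae_eq_integral (cst 0%E)) ?integral0 ?poweR0r//.
- by apply/measurable_EFinP; exact: measurable_funX.
- by move: f0; apply: filterS => x f0x _ /=; rewrite f0x// expr0n.
Qed.

(** From rank [N] on, the partial sums of [u] agree almost everywhere with the proposed limit, so
    the norms are eventually zero. *)
Lemma L2_series_finite : (forall r, L20 mu (v r)) ->
  L2_series mu u (fun x => \sum_(1 <= r < N.+1) v r x).
Proof.
move=> v0; split; first by apply: L20_sum.
apply: cvg_near_cst; exists N => // n /= Nn.
(* Countably many null sets are merged into one that serves all [r]. *)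
have uv_ae : {ae mu, forall x r, u r x = v r x}.
  apply: ae_foralln => r; move: (uv r); apply: filterS => x; exact.
apply: Lnorm2_ae0.
  apply: measurable_funB; first exact: measurable_sum.
  by apply: measurable_sum => r; exact: (Lfun2_measurable (v0 r).1).
move: uv_ae; apply: filterS => x uvx _ /=.
rewrite (@big_cat_nat _ _ _ N.+1)//= addrAC.
rewrite (eq_bigr (v^~ x)) ?subrr ?add0r//.
by rewrite big_nat big1// => r /andP[Nr _]; rewrite uvx vN// ltnW.
Qed.

End FinitelySupportedSeries.

(** * Sums over windows *)

Section WindowSums.
Context d d' (Om : measurableType d) (E : measurableType d') (R : realType)
  (P : probability Om R) (nu : probability E R) (K : R.-pker E ~> E)
  (X : int -> {RV P >-> E}).
Hypothesis XP : stationary_markov_chain nu K X.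
Variables (m k : nat) (h : m.+1.-tuple E -> R).
Hypotheses (m0 : (0 < m)%N) (mk : (m < k)%N) (hI : incremental X h).

Let N := (k - m.+1 + 1)%N.
Let mu := block_law X k.

(** [hhat k h] is [window_sum 0 N] by conversion. Applying the transition operator raises the lower
    bound of [window_sum r N]; applying the adjoint lowers the upper bound of [window_sum 0 q]. *)
Definition window_sum r q (x : k.-tuple E) : R :=
  \sum_(r <= i < q) h (window i m.+1 x).

Let Nm : (N + m = k)%N. Proof. by rewrite /N addn1 addSnnS subnK. Qed.
Let k0 : (0 < k)%N. Proof. exact: leq_trans mk. Qed.

Let window_le i : (i < N)%N -> (i + m.+1 <= k)%N.
Proof. by move=> iN; rewrite addnS -addSn -Nm leq_add2r. Qed.

Let h0 : L20 (block_law X m.+1) h. Proof. by case: hI. Qed.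
Let mh : measurable_fun [set: m.+1.-tuple E] h.
Proof. exact: Lfun2_measurable h0.1. Qed.

Lemma L20_window i : (i < N)%N ->
  L20 mu (fun x : k.-tuple E => h (window i m.+1 x)).
Proof.
by move=> /window_le im; exact: (preserving_L20 (window_preserving XP im) h0).
Qed.

Lemma L20_window_sum r q : (q <= N)%N -> L20 mu (window_sum r q).
Proof.
move=> qN; rewrite /window_sum; under eq_fun do rewrite big_nat.
by apply: L20_sum => i /andP[_ iq]; apply: L20_window; exact: leq_trans qN.
Qed.

Lemma measurable_window_sum r q : (q <= N)%N ->
  measurable_fun [set: k.-tuple E] (window_sum r q).
Proof. by move=> qN; exact: (Lfun2_measurable (L20_window_sum r qN).1). Qed.

Lemma measurable_transition f : measurable_fun [set: k.-tuple E] f ->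
  measurable_fun [set: k.-tuple E] (transition K k f).
Proof.
move=> mf; have mw := @measurable_window _ E 1 k k.+1.
exact: (measurable_last_step_mean K (measurableT_comp mf mw)).
Qed.

(** The operator acts on functions and must be shown to respect null sets: these pull back to
    [k.+1]-blocks along the shift, then are negligible on almost every fibre of the last
    coordinate. *)
Lemma transition_ae_eq f g : measurable_fun [set: k.-tuple E] f ->
  measurable_fun [set: k.-tuple E] g -> f = g %[ae mu] ->
  transition K k f = transition K k g %[ae mu].
Proof.
move=> mf mg fg; have mw := @measurable_window _ E 1 k k.+1.
apply: (last_step_mean_ae_eq XP k0
  (measurableT_comp mf mw) (measurableT_comp mg mw)).
exact: (preserving_ae (window_preserving XP (leqnn (1 + k))) fg).
Qed.

(** The shift moves each window one place to the right. Windows still inside [x] do not involve [z];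
    the last one becomes [rcons (window N m x) z], where the mean of [h] over [z] vanishes. *)
Lemma transition_window_sum r :
  transition K k (window_sum r N) = window_sum r.+1 N %[ae mu].
Proof.
(* Since [N + m = k], [window N m] extracts the last [m] entries; exceptional sets of [m]-tuples are
   pulled back along it. *)
have presN := window_preserving XP (eq_leq Nm).
have := preserving_ae presN (last_step_mean_incremental XP m0 hI).
have := preserving_ae presN (last_step_ae_integrable XP m0 mh h0.1).
apply: filterS2 => x /= hi hm _; move/(_ I) : hm.
rewrite /last_step_mean last_window ?size_tuple// => hm.
rewrite last_window ?size_tuple// in hi.
have [Nr|rN] := leqP N r.
  rewrite /transition /window_sum; under eq_Rintegral do rewrite big_geq//.
  by rewrite Rintegral_cst// mul0r big_geq// leqW.
have N1 : N = N.-1.+1 by rewrite prednK// (leq_ltn_trans _ rN).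
have rN1 : (r <= N.-1)%N by rewrite -ltnS -N1.
transitivity (\int[K (last point x)]_z
    (window_sum r.+1 N x + h [tuple of rcons (window N m x) z])).
  apply: eq_Rintegral => z _; rewrite /window_sum N1 big_nat_recr//= big_add1.
  congr (_ + h _); last first.
    by rewrite window_window ?add1n -?N1 ?window_rcons_last ?size_tuple//
       ?addnS -?addSn -N1 Nm.
  rewrite !big_nat; apply: eq_bigr => i /andP[_ iN].
  have iN' : (i.+1 < N)%N by rewrite N1.
  rewrite window_window ?add1n; last by apply: window_le; exact: ltnW.
  by rewrite window_rcons// size_tuple; exact: window_le.
rewrite RintegralD//; last exact: kernel_integrable_cst.
by rewrite hm addr0 Rintegral_cst// prob_kernel mulr1.
Qed.

(** Measurability is carried through the induction because [transition_ae_eq] uses it at each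
    step. *)
Lemma iter_transition r :
  measurable_fun [set: k.-tuple E] (iter r (transition K k) (hhat k h)) /\
  iter r (transition K k) (hhat k h) = window_sum r N %[ae mu].
Proof.
elim: r => [|r [mIH IH]] /=.
  by split; [exact: measurable_window_sum|exact: ae_eq_refl].
split; first exact: measurable_transition.
apply: ae_eq_trans (transition_window_sum r).
by apply: transition_ae_eq => //; exact: measurable_window_sum.
Qed.

(** On [k.+1]-blocks, the pairing with [g_i] is the mean of [u (X_2, ..., X_(k+1)) h (X_(i+1), ...,
    X_(i+m+1))]. For [i = 0] it is zero by [incremental_orthogonal_future]; for [i > 0] stationarity
    gives the pairing of [u] with [g_(i-1)]. *)
Lemma inner_transition_window_sum u q : u \in Lfun mu 2%:E -> (q <= N)%N ->
  inner mu (transition K k u) (window_sum 0 q) = inner mu u (window_sum 0 q.-1).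
Proof.
move=> u2; have pres1 := window_preserving XP (leqnn (1 + k)).
have uw2 := preserving_Lfun2 pres1 u2.
have mu' := Lfun2_measurable u2; have muw := Lfun2_measurable uw2.
have Tu2 := last_step_mean_Lfun2 XP k0 muw uw2.
have transE i : (i < N)%N ->
    inner mu (transition K k u) (fun x : k.-tuple E => h (window i m.+1 x)) =
    inner (block_law X k.+1) (fun y : k.+1.-tuple E => u (window 1 k y))
      (fun y : k.+1.-tuple E => h (window i m.+1 y)).
  move=> iN; rewrite -(last_step_mean_inner XP k0 muw uw2 (L20_window iN).1).
  by congr inner; apply/funext => y; rewrite window_window//; exact: window_le.
have sumS r : window_sum 0 r.+1 =
    (fun x => window_sum 0 r x + h (window r m.+1 x)).
  by apply/funext => x; rewrite /window_sum big_nat_recr.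
have sum0 : window_sum 0 0 = cst 0.
  by apply/funext => x; rewrite /window_sum big_geq.
have inner0 w : inner mu w (cst 0) = 0.
  rewrite /inner; under eq_Rintegral do rewrite mulr0.
  by rewrite Rintegral_cst// mul0r.
elim: q => [|q IH] qN; first by rewrite /= sum0 !inner0.
have L2 r : (r <= N)%N -> window_sum 0 r \in Lfun mu 2%:E.
  by move=> rN; exact: (L20_window_sum 0 rN).1.
rewrite sumS innerDr//; [|exact: L2 (ltnW qN)|exact: (L20_window qN).1].
rewrite IH ?(ltnW qN)// transE//.
case: q qN {IH} => [|q] qN /=.
  rewrite sum0 inner0 add0r.
  by apply: (incremental_orthogonal_future XP m0 hI) => //; exact: ltnW.
rewrite sumS innerDr//; last 2 first.
- exact: L2 (ltnW (ltnW qN)).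
- exact: (L20_window (ltnW qN)).1.
congr (_ + _).
have mhw : measurable_fun [set: k.-tuple E]
    (fun x : k.-tuple E => h (window q m.+1 x)).
  exact: (Lfun2_measurable (L20_window (ltnW qN)).1).
rewrite -(preserving_inner pres1 mu' mhw).
congr inner; apply/funext => y /=; rewrite window_window ?add1n//.
by apply: window_le; exact: ltnW.
Qed.

(** [window_sum 0 q.-1] satisfies the defining property of the adjoint, so [xget] returns some
    function with that property; two such functions agree almost everywhere. *)
Lemma adjoint_window_sum f q : (q <= N)%N ->
  measurable_fun [set: k.-tuple E] f -> f = window_sum 0 q %[ae mu] ->
  measurable_fun [set: k.-tuple E] (adjoint mu (transition K k) f) /\
  adjoint mu (transition K k) f = window_sum 0 q.-1 %[ae mu].
Proof.
move=> qN mf fq; have q1N : (q.-1 <= N)%N by exact: leq_trans (leq_pred _) qN.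
have s0 := L20_window_sum 0 q1N.
pose A := [set g | L20 mu g /\
  forall u, L20 mu u -> inner mu (transition K k u) f = inner mu u g].
have As : A (window_sum 0 q.-1).
  split=> // u [u2 _]; rewrite -inner_transition_window_sum//.
  have mTu := measurable_transition (Lfun2_measurable u2).
  apply: ae_eq_Rintegral.
  - exact: measurable_funM.
  - by apply: measurable_funM => //; exact: measurable_window_sum.
  - by move: fq; apply: filterS => x fqx _; rewrite fqx.
have [[g2 g0] Ag] : A (adjoint mu (transition K k) f).
  by apply: xgetPex; exists (window_sum 0 q.-1).
set g := adjoint mu (transition K k) f in g2 g0 Ag *.
split; first exact: Lfun2_measurable g2.
(* The difference of the two candidates serves as its own test function: [inner mu w w = 0]. *)
pose w x := g x - window_sum 0 q.-1 x.
have w2 : w \in Lfun mu 2%:E by exact: Lfun2B g2 s0.1.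
have w0 : L20 mu w.
  split=> //; rewrite RintegralB//; last 2 first.
  - exact: Lfun2_integrable g2.
  - exact: Lfun2_integrable s0.1.
  by rewrite g0 s0.2 subrr.
have : inner mu w w = 0.
  rewrite {1}/w innerBl//; last exact: s0.1.
  by rewrite ![inner mu _ w]innerC -Ag// As.2// subrr.
move=> /(inner_eq0 w2); apply: filterS => x + _ => /(_ I).
by rewrite /w => /eqP; rewrite subr_eq0 => /eqP.
Qed.

(** Truncated subtraction matches the predecessor in [adjoint_window_sum] and keeps the sum empty
    once [r] exceeds [N]. *)
Lemma iter_adjoint r :
  measurable_fun [set: k.-tuple E]
    (iter r (adjoint mu (transition K k)) (hhat k h)) /\
  iter r (adjoint mu (transition K k)) (hhat k h) =
    window_sum 0 (N - r) %[ae mu].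
Proof.
elim: r => [|r [mIH IH]].
  by rewrite subn0; split; [exact: measurable_window_sum|exact: ae_eq_refl].
by rewrite subnS; apply: adjoint_window_sum => //; rewrite leq_subr.
Qed.

(** With [S_r = window_sum 0 r x], the tails are [S_N - S_r]. The total telescopes to
    [S_N + N * S_N - S_N + S_0], where [S_0 = 0]. *)
Lemma sum_window_sums x :
  hhat k h x + \sum_(1 <= r < N.+1) window_sum r N x +
    \sum_(1 <= r < N.+1) window_sum 0 (N - r) x = N%:R * hhat k h x.
Proof.
have split_sum r : (r <= N)%N ->
    window_sum r N x = hhat k h x - window_sum 0 r x.
  move=> rN; rewrite [hhat _ _ _](_ : _ = window_sum 0 N x)//.
  rewrite /window_sum [in RHS](big_cat_nat (leq0n r) rN)/=.
  by rewrite addrAC subrr add0r.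
have -> : \sum_(1 <= r < N.+1) window_sum 0 (N - r) x =
    \sum_(0 <= r < N) window_sum 0 r x.
  by rewrite big_add1 /= [RHS]big_nat_rev.
have -> : \sum_(1 <= r < N.+1) window_sum r N x =
    \sum_(1 <= r < N.+1) (hhat k h x - window_sum 0 r x).
  by rewrite !big_nat; apply: eq_bigr => r /andP[_ rN]; exact: split_sum.
rewrite sumrB sumr_const_nat subn1 /= -(mulr_natl (hhat k h x)).
have : \sum_(0 <= r < N) window_sum 0 r x + hhat k h x =
    0 + \sum_(1 <= r < N.+1) window_sum 0 r x.
  transitivity (\sum_(0 <= r < N.+1) window_sum 0 r x).
    by rewrite big_nat_recr.
  by rewrite big_ltn// {1}/window_sum (@big_geq _ _ _ 0 0).
by rewrite add0r => <-; ring.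
Qed.

End WindowSums.

(** * Assembling the two finite series *)

Theorem theorem3p5 (R : realType) (d d' : measure_display)
    (Om : measurableType d) (E : measurableType d') (P : probability Om R)
    (nu : probability E R) (K : R.-pker E ~> E) (X : int -> {RV P >-> E})
    (m k : nat) (h : m.-tuple E -> R) :
  stationary_markov_chain nu K X ->
  (2 <= m)%N -> (m <= k)%N ->
  incremental X h ->
  [/\ finite_set (nonzero_terms (block_law X k)
        (fun r => iter r (transition K k) (hhat k h))),
      finite_set (nonzero_terms (block_law X k)
        (fun r => iter r (adjoint (block_law X k) (transition K k))
                    (hhat k h))) &
      green_kubo (block_law X k) (transition K k) (hhat k h)
        (fun x => (k - m + 1)%:R * hhat k h x)].
Proof.
move=> XP; case: m h => [//|m] h; rewrite ltnS => m0 mk hI.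
set N := (k - m.+1 + 1)%N.
have itP r := iter_transition XP m0 mk hI r.
have itA r := iter_adjoint XP m0 mk hI r.
have P0 r : (N <= r)%N -> window_sum (k := k) h r N = cst 0.
  by move=> Nr; apply/funext => x; rewrite /window_sum big_geq.
have A0 r : (N <= r)%N -> window_sum (k := k) h 0 (N - r) = cst 0.
  by move=> Nr; apply/funext => x; rewrite /window_sum big_geq// leqn0 subn_eq0.
split.
- exact: finite_nonzero_terms (fun r => (itP r).2) P0.
- exact: finite_nonzero_terms (fun r => (itA r).2) A0.
split; first exact: (L20_window_sum XP mk hI 0 (leqnn _)).
(* The limits are the explicit sums over [1 <= r <= N]; the term [r = N] is already zero and is kept
   to match the indexing of [L2_series_finite]. *)
exists (fun x => \sum_(1 <= r < N.+1) window_sum h r N x),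
  (fun x => \sum_(1 <= r < N.+1) window_sum h 0 (N - r) x); split.
- apply: L2_series_finite P0 _ => r; [exact: (itP r).1|exact: (itP r).2|].
  exact: (L20_window_sum XP mk hI r (leqnn _)).
- apply: L2_series_finite A0 _ => r; [exact: (itA r).1|exact: (itA r).2|].
  exact: (L20_window_sum XP mk hI 0 (leq_subr _ _)).
- by apply/aeW => x _ /=; rewrite sum_window_sums.
Qed.
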